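(* Let $U$ and $\mathscr A$ be Hilbert spaces. Let $G:U\times\mathscr A\to U$ and $S_u:\mathscr A\to U$ be Lipschitz continuously differentiable and satisfy $$\nabla_\alpha S_u(\alpha)\nabla_uG(S_u(\alpha);\alpha)+\nabla_\alpha G(S_u(\alpha);\alpha)=0 .$$ Let $Q\in\mathbb L(U;U)$ be positive definite and self-adjoint, and $P=\mathbb L(U;\mathscr A)$. For $v=(u,\alpha)\in U\times\mathscr A$ define $A_v\in\mathbb L(P;P)$ and $b_v\in P$ by $$A_vp:=p\,\nabla_uG(u;\alpha),\qquad b_v:=-\nabla_\alpha G(u;\alpha).$$ Suppose that $v\mapsto b_v$ is $L_b$-Lipschitz, that $\|A_v-A_{\tilde v}\|\le L_A\|v-\tilde v\|$ for all $v,\tilde v$, and that there are splittings $A_v=N_v+M_v$ with $N_v$ invertible, $\|N_v^{-1}M_v\|\le\zeta$ and $\gamma_N\|N_v^{-1}\|\le1$ for some $\zeta\in(0,1)$ and $\gamma_N>0$. Let $V_\alpha\subset\mathscr A$, $u\in U$, $\alpha\in V_\alpha$, $v=(u,\alpha)$, and, for given $p^k\in P$, let $p^{k+1}$ solve $N_vp^{k+1}+M_vp^k=b_v$. Then $p^{k+1}$ satisfies the adjoint tracking property $$\kappa_p\|p^{k+1}-\nabla_\alpha S_u(\alpha)\|_{Q^{-1}}\le\|p^k-\nabla_\alpha S_u(\breve\alpha)\|_{Q^{-1}}+C_S\|u-S_u(\alpha)\|_Q+\pi_p\|\alpha-\breve\alpha\|$$ for any $\breve\alpha\in V_\alpha$,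 with the constants $$\kappa_p=\zeta^{-1},\qquad C_S=\sup_{\alpha\in V_\alpha}\zeta^{-1}\gamma_N^{-1}\bigl(L_A\|\nabla_\alpha S_u(\alpha)\|_{Q^{-1}}+L_b\bigr),\qquad \pi_p=L_{\nabla_\alpha S_u},$$ where $L_{\nabla_\alpha S_u}$ is the Lipschitz factor of $\nabla_\alpha S_u$.
   Context: $\mathbb L(X;Y)$: bounded linear operators. $\|x\|_Q:=\sqrt{\langle Qx,x\rangle}$ and, for $p\in\mathbb L(U;\mathscr A)$, $\|p\|_{Q^{-1}}:=\|pQ^{-1/2}\|_{\mathbb L(U;\mathscr A)}$. $\nabla_\alpha S_u(\alpha):=S_u'(\alpha)^*\in\mathbb L(U;\mathscr A)$; $\nabla_uG(u;\alpha)\in\mathbb L(U;U)$ and $\nabla_\alpha G(u;\alpha)\in\mathbb L(U;\mathscr A)$ are the Hilbert adjoints of the partial Fréchet derivatives. In the hypotheses and constants, $P$ is normed by $\|\cdot\|_{Q^{-1}}$ (operators on $P$ by the induced operator norm), and $U\times\mathscr A$ is normed using $\|\cdot\|_Q$ on $U$, i.e. $\|(u,\alpha)\|^2=\|u\|_Q^2+\|\alpha\|^2$. *)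

(* Defs.v *)
From HB Require Import structures.
From mathcomp Require Import all_boot all_order all_algebra.
From mathcomp Require Import all_classical all_reals all_analysis.

Set Implicit Arguments.
Unset Strict Implicit.
Unset Printing Implicit Defensive.

Import Order.TTheory GRing.Theory Num.Theory.
Import numFieldNormedType.Exports.

Local Open Scope classical_set_scope.
Local Open Scope ring_scope.

(** * Real Hilbert spaces *)

HB.mixin Record isInnerProduct (R : realType) U of CompleteNormedModule R U := {
  hdot : U -> U -> R ;
  hdotC : forall x y, hdot x y = hdot y x ;
  hdot_linear : forall (a : R) x y z,
    hdot (a *: x + y) z = a * hdot x z + hdot y z ;
  hdot_norm : forall x, hdot x x = `|x| ^+ 2
}.

#[short(type="hilbertType")]
HB.structure Definition Hilbert (R : realType) :=
  {U of CompleteNormedModule R U & isInnerProduct R U}.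

(** * Bounded linear operators

    Boundedness is expressed by continuity, see
    [bounded_linear_continuous] and [continuous_linear_bounded]. *)

Section BoundedOperators.
Context {R : realType}.

Definition is_blin (X Y : normedModType R) : pred (X -> Y) :=
  fun f => `[< linear f /\ continuous f >].

Record blin (X Y : normedModType R) :=
  Blin { blin_fun :> X -> Y ; _ : is_blin blin_fun }.

HB.instance Definition _ (X Y : normedModType R) :=
  [isSub for @blin_fun X Y].
HB.instance Definition _ (X Y : normedModType R) :=
  [Choice of blin X Y by <:].

Lemma is_blin_submod (X Y : normedModType R) : submod_closed (@is_blin X Y).
Proof.
split.
  apply/asboolP; split=> [a x y|x]; last exact: cst_continuous.
  by rewrite /= scaler0 addr0.
move=> a f g /asboolP[lf cf] /asboolP[lg cg]; apply/asboolP; split.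
  move=> b x y; rewrite /= !fctE lf lg !scalerDr !scalerA (mulrC a b).
  by rewrite addrACA.
move=> x; apply: (@continuousD R Y X (fun z => a *: f z) g x).
  by apply: continuousZl_tmp; exact: cf.
exact: cg.
Qed.

HB.instance Definition _ (X Y : normedModType R) :=
  GRing.isSubmodClosed.Build R (X -> Y) (@is_blin X Y) (@is_blin_submod X Y).
HB.instance Definition _ (X Y : normedModType R) :=
  [SubChoice_isSubLmodule of blin X Y by <:].

Lemma blinP (X Y : normedModType R) (f : blin X Y) : linear f /\ continuous f.
Proof. by case: f => f /= /asboolP. Qed.

Lemma is_blin_comp (X Y Z : normedModType R) (g : blin Y Z) (f : blin X Y) :
  is_blin (g \o f).
Proof.
have [lf cf] := blinP f; have [lg cg] := blinP g.
apply/asboolP; split=> [a x y|x]; first by rewrite /= lf lg.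
by apply: continuous_comp; [exact: cf|exact: cg].
Qed.

Definition bcomp (X Y Z : normedModType R) (g : blin Y Z) (f : blin X Y)
  : blin X Z := Blin (is_blin_comp g f).

(** The operator norm of [f] with respect to given (semi)norms on its domain
    and codomain; only meaningful for bounded [f]. *)
Definition opnorm (X Y : Type) (nX : X -> R) (nY : Y -> R) (f : X -> Y) : R :=
  sup [set nY (f x) | x in [set x | nX x <= 1]].

(** Membership in L(X;X) when X carries the norm [nX]. *)
Definition bounded_op (X : lmodType R) (nX : X -> R) (f : X -> X) : Prop :=
  linear f /\ exists C : R, forall x, nX (f x) <= C * nX x.

(** The existence of a Lipschitz constant for the derivative does not depend on
    the choice of equivalent norms, so the canonical ones are used here. *)
Definition lipschitz_C1 (X Y : normedModType R) (f : X -> Y) : Prop :=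
  (forall x, differentiable f x) /\
  exists L : R, forall x y,
    opnorm Num.norm Num.norm ('d f x \- 'd f y) <= L * `|x - y|.

End BoundedOperators.

Notation "g '\ob' f" := (bcomp g f) (at level 40, left associativity).

(** * Adjoints, gradients, weighted norms *)

Section HilbertOperators.
Context {R : realType}.
Implicit Types U V W : hilbertType R.

(** The Hilbert adjoint: the unique bounded operator [g] such that
    <f x, y> = <x, g y>. It exists whenever [f] is linear and continuous; the
    default value is never used for such [f]. *)
Definition adjoint V W (f : V -> W) : blin W V :=
  xget 0 [set g : blin W V | forall x y, hdot (f x) y = hdot x (g y)].

Lemma adjoint_eq V W (f : V -> W) (g : blin W V) :
  (forall x y, hdot (f x) y = hdot x (g y)) -> adjoint f = g.
Proof.
move=> fg; rewrite /adjoint.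
case: xgetP => [h _ /= fh|/(_ g)/(_ fg)//].
apply/val_inj/funext => y /=; apply/eqP; rewrite -subr_eq0 -normr_eq0.
rewrite -sqrf_eq0 -hdot_norm.
have -> : h y - g y = (-1 : R) *: g y + h y by rewrite scaleN1r addrC.
set z := _ *: _ + _.
by rewrite {1}/z hdot_linear (hdotC (g y)) (hdotC (h y)) -fg -fh mulN1r addNr.
Qed.

Definition grad V W (S : V -> W) (x : V) : blin W V := adjoint ('d S x).

Definition grad1 U V W (G : U * V -> W) (v : U * V) : blin W U :=
  grad (fun u => G (u, v.2)) v.1.

Definition grad2 U V W (G : U * V -> W) (v : U * V) : blin W V :=
  grad (fun a => G (v.1, a)) v.2.

Definition selfadjoint U (Q : blin U U) : Prop :=
  forall x y, hdot (Q x) y = hdot x (Q y).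

(** Coercivity is the notion of positive definiteness under which [Q] has a
    bounded inverse square root. *)
Definition posdef U (Q : blin U U) : Prop :=
  exists2 c : R, 0 < c & forall x, c * `|x| ^+ 2 <= hdot (Q x) x.

(** Q^{-1/2}: the unique positive semidefinite self-adjoint bounded [T] with
    T^2 = Q^{-1}. It exists whenever [Q] is self-adjoint and positive
    definite. *)
Definition invsqrt U (Q : blin U U) : blin U U :=
  xget 0 [set T : blin U U |
    [/\ selfadjoint T, forall x, 0 <= hdot (T x) x,
        forall x, T (T (Q x)) = x & forall x, Q (T (T x)) = x]].

Definition normQ U (Q : blin U U) (x : U) : R := Num.sqrt (hdot (Q x) x).

Definition normQinv U V (Q : blin U U) (p : blin U V) : R :=
  opnorm Num.norm Num.norm (p \ob invsqrt Q).

(** The norm of U x V in which the Lipschitz constants are measured; it is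
    equivalent to, but different from, the maximum norm that the library puts on
    products. *)
Definition normQprod U V (Q : blin U U) (v : U * V) : R :=
  Num.sqrt (normQ Q v.1 ^+ 2 + `|v.2| ^+ 2).

(** The operator norm on L(P;P) for P = L(U;V) normed by [normQinv Q]. *)
Definition opnormP U V (Q : blin U U) (F : blin U V -> blin U V) : R :=
  opnorm (normQinv Q) (normQinv Q) F.

(** The linear adjoint equation A_v p = b_v at v = (u, alpha). *)
Definition adjA U V (G : U * V -> U) (v : U * V) (p : blin U V) : blin U V :=
  p \ob grad1 G v.

Definition adjb U V (G : U * V -> U) (v : U * V) : blin U V := - grad2 G v.

End HilbertOperators.

(* Main.v *)
From HB Require Import structures.
Require Import Defs.
From mathcomp Require Import all_boot all_order all_algebra.
From mathcomp Require Import all_classical all_reals all_analysis.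

Set Implicit Arguments.
Unset Strict Implicit.
Unset Printing Implicit Defensive.

Import Order.TTheory GRing.Theory Num.Theory.
Import numFieldNormedType.Exports.

Local Open Scope classical_set_scope.
Local Open Scope ring_scope.

(** One splitting step applied to the adjoint equation at [v = (u, alpha)] is a
    contraction towards the solution of that equation, and [grad S alpha]
    almost solves it.  By hypothesis [g := grad S alpha] solves the adjoint
    equation at [v0 := (S alpha, alpha)] exactly, so at [v] it leaves the residual

      b_v - A_v g = (b_v - b_v0) + (A_v0 - A_v) g,

    and since [v - v0 = (u - S alpha, 0)], the two Lipschitz hypotheses bound
    this residual by [(L_b + L_A ||g||) ||u - S alpha||_Q].  Subtracting
    [N_v g + M_v g = A_v g] from the equation that defines [p'] gives the error
    recursion

      p' - g = N_v^-1 (b_v - A_v g) - N_v^-1 M_v (p - g),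

    hence [||p' - g|| <= zeta ||p - g|| + gamma_N^-1 ||b_v - A_v g||]; this is
    [splitting_step_error_le].  Dividing by [zeta] and comparing
    [grad S alpha] with [grad S beta] in [||p - g||] yields the claim.

    The analytic input is that an operator norm, being defined as a supremum
    over a unit ball, bounds the operator ([le_opnorm]); of [normQinv] only the
    seminorm properties enter. *)

Section OperatorNorm.
Context {R : realType}.

(** Boundedness of [f] is what makes the supremum finite; the junk value of
    [sup] on unbounded sets would break the inequality. *)
Lemma le_opnorm_ball (X Y : Type) (nX : X -> R) (nY : Y -> R) (f : X -> Y)
    (C : R) :
  (forall x, 0 <= nX x) -> (forall x, nY (f x) <= C * nX x) ->
  forall x, nX x <= 1 -> nY (f x) <= opnorm nX nY f.
Proof.
move=> nX0 fC x x1; apply: ub_le_sup; last by exists x.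
exists `|C| => _ [z z1 <-]; apply: le_trans (fC z) _.
apply: (@le_trans _ _ (`|C| * nX z)); first by rewrite ler_wpM2r ?ler_norm.
by rewrite ler_piMr.
Qed.

(** A vector [x] with [nX x = 0] cannot be normalised, so there the bound has to
    come from the boundedness of [f], which forces [nY (f x) = 0].  Elsewhere
    the supremum is compared with its value at [(nX x)^-1 *: x]. *)
Lemma le_opnorm (X Y : lmodType R) (nX : X -> R) (nY : Y -> R) (f : X -> Y)
    (C : R) :
  (forall x, 0 <= nX x) -> (forall a x, nX (a *: x) <= `|a| * nX x) ->
  (forall y, 0 <= nY y) -> (forall a y, nY (a *: y) <= `|a| * nY y) ->
  (forall a x, f (a *: x) = a *: f x) ->
  (forall x, nY (f x) <= C * nX x) ->
  forall x, nY (f x) <= opnorm nX nY f * nX x.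
Proof.
move=> nX0 nXZ nY0 nYZ fZ fC x.
have [x0|x_neq0] := eqVneq (nX x) 0.
  by have := fC x; rewrite x0 !mulr0.
have x_gt0 : 0 < nX x by rewrite lt_neqAle eq_sym x_neq0 nX0.
pose y := (nX x)^-1 *: x.
have y1 : nX y <= 1.
  apply: le_trans (nXZ _ _) _.
  by rewrite ger0_norm ?invr_ge0// mulVf.
have xE : f x = nX x *: f y by rewrite -fZ scalerA divff// scale1r.
rewrite {1}xE; apply: le_trans (nYZ _ _) _.
by rewrite ger0_norm// mulrC ler_wpM2r//; exact: le_opnorm_ball y1.
Qed.

Lemma opnorm_le (X Y : normedModType R) (f : X -> Y) (C : R) :
  0 <= C -> (forall x, `|f x| <= C * `|x|) ->
  opnorm Num.norm Num.norm f <= C.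
Proof.
move=> C0 fC; apply: ge_sup; first by exists `|f 0|; exists 0 => //=; rewrite normr0.
by move=> _ [x x1 <-]; apply: le_trans (fC x) _; rewrite ler_piMr.
Qed.

Lemma blin_scalable (X Y : normedModType R) (f : blin X Y) a x :
  f (a *: x) = a *: f x.
Proof. by have [lf _] := blinP f; exact: (scalable_linear lf). Qed.

Lemma blin_bounded (X Y : normedModType R) (f : blin X Y) :
  exists C : R, forall x, `|f x| <= C * `|x|.
Proof.
have [lf cf] := blinP f.
pose fl := GRing.isLinear.Build R X Y *:%R (f : X -> Y) lf.
pose F : {linear X -> Y} := HB.pack (f : X -> Y) fl.
have /linear_boundedP : bounded_near F (nbhs 0).
  by apply: continuous_linear_bounded; exact: cf.
by move=> /pinfty_ex_gt0[C _ FC]; exists C.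
Qed.

Lemma le_opnorm_blin (X Y : normedModType R) (f : blin X Y) x :
  `|f x| <= opnorm Num.norm Num.norm f * `|x|.
Proof.
have [C fC] := blin_bounded f.
apply: (le_opnorm (C := C)) => //; [|..|exact: blin_scalable].
- by move=> a y; rewrite normrZ.
- by move=> a y; rewrite normrZ.
Qed.

Lemma opnorm_ge0 (X Y : normedModType R) (f : blin X Y) :
  0 <= opnorm Num.norm Num.norm f.
Proof.
have [C fC] := blin_bounded f.
apply: le_trans (normr_ge0 (f 0)) _.
by apply: (le_opnorm_ball (C := C)) => //; rewrite normr0.
Qed.

End OperatorNorm.

Section WeightedNorm.
Context {R : realType} {U V : hilbertType R} (Q : blin U U).
Implicit Types p q : blin U V.

Lemma normQinv_ge0 p : 0 <= normQinv Q p.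
Proof. exact: opnorm_ge0. Qed.

Lemma ler_normQinvD p q : normQinv Q (p + q) <= normQinv Q p + normQinv Q q.
Proof.
apply: opnorm_le => [|x]; first by rewrite addr_ge0// normQinv_ge0.
rewrite mulrDl; apply: le_trans (ler_normD (p _) (q _)) _.
by rewrite lerD//; exact: (le_opnorm_blin (_ \ob _)).
Qed.

Lemma ler_normQinvZ a p : normQinv Q (a *: p) <= `|a| * normQinv Q p.
Proof.
apply: opnorm_le => [|x]; first by rewrite mulr_ge0// normQinv_ge0.
rewrite -mulrA; have -> : (a *: p \ob invsqrt Q) x = a *: p (invsqrt Q x) by [].
by rewrite normrZ ler_wpM2l//; exact: (le_opnorm_blin (_ \ob _)).
Qed.

Lemma normQ_ge0 (x : U) : 0 <= normQ Q x.
Proof. exact: sqrtr_ge0. Qed.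

Lemma normQprod_fst (x : U) : normQprod Q (x, 0 : V) = normQ Q x.
Proof. by rewrite /normQprod normr0 expr0n addr0 sqrtr_sqr ger0_norm ?normQ_ge0. Qed.

End WeightedNorm.

Section SplittingStep.
Context {R : realType} {P : lmodType R} (nP : P -> R).
Hypotheses (nP_ge0 : forall p, 0 <= nP p)
  (nPD : forall p q, nP (p + q) <= nP p + nP q)
  (nPZ : forall a p, nP (a *: p) <= `|a| * nP p).

Lemma bounded_op_comp (f g : P -> P) :
  bounded_op nP f -> bounded_op nP g -> bounded_op nP (f \o g).
Proof.
move=> [lf [C fC]] [lg [D gD]]; split=> [a x y|]; first by rewrite /= lg lf.
exists (`|C| * D) => x; apply: le_trans (fC _) _.
apply: (@le_trans _ _ (`|C| * nP (g x))); first by rewrite ler_wpM2r ?ler_norm.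
by rewrite -mulrA ler_wpM2l.
Qed.

Lemma bounded_op_lincomb (a : R) (f g : P -> P) :
  bounded_op nP f -> bounded_op nP g -> bounded_op nP (fun p => a *: f p + g p).
Proof.
move=> [lf [C fC]] [lg [D gD]]; split=> [b x y|].
  by rewrite lf lg !scalerDr !scalerA (mulrC a b) addrACA.
exists (`|a| * C + D) => x; apply: le_trans (nPD _ _) _.
rewrite mulrDl lerD//; apply: le_trans (nPZ _ _) _.
by rewrite -mulrA ler_wpM2l.
Qed.

Lemma le_opnorm_op (f : P -> P) (C : R) p :
  bounded_op nP f -> opnorm nP nP f <= C -> nP (f p) <= C * nP p.
Proof.
move=> [lf [D fD]] fC; apply: (@le_trans _ _ (opnorm nP nP f * nP p)).
  by apply: (le_opnorm (C := D)) => //; exact: (scalable_linear lf).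
by rewrite ler_wpM2r.
Qed.

(** The reference point [g] is arbitrary: when it solves [N g + M g = b] the
    last term vanishes and this is the contraction estimate of the stationary
    iteration.  Otherwise the residual of [g] enters as a perturbation. *)
Lemma splitting_step_error_le (N M Ninv : P -> P) (zeta gamma : R)
    (p p' g b : P) :
  bounded_op nP N -> bounded_op nP M -> bounded_op nP Ninv -> cancel N Ninv ->
  opnorm nP nP (Ninv \o M) <= zeta -> 0 < gamma ->
  gamma * opnorm nP nP Ninv <= 1 ->
  N p' + M p = b ->
  nP (p' - g) <= gamma^-1 * nP (b - (N g + M g)) + zeta * nP (p - g).
Proof.
move=> bN bM bNinv NK NinvM_le gamma0 Ninv_le p'E.
have lN := bN.1; have lM := bM.1; have lNinv := bNinv.1.
have NinvM_lin := (bounded_op_comp bNinv bM).1.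
have error : p' - g = Ninv (b - (N g + M g)) + (-1) *: (Ninv \o M) (p - g).
  rewrite -(scalable_linear NinvM_lin) scaleN1r opprB /=.
  rewrite (zmod_morphism_linear lM).
  rewrite -[Ninv (b - _)]scale1r -lNinv scale1r -p'E.
  rewrite -[LHS]NK (zmod_morphism_linear lN); congr (Ninv _).
  by rewrite opprD (addrACA (N p')) -[RHS]addrA subrKA subrr addr0.
rewrite error; apply: le_trans (nPD _ _) _; apply: lerD.
  by apply: le_opnorm_op => //; rewrite -[leRHS]mulr1 ler_pdivlMl.
apply: le_trans (nPZ _ _) _; rewrite normrN1 mul1r.
by apply: le_opnorm_op => //; exact: bounded_op_comp.
Qed.

End SplittingStep.

Theorem theorem4p9 (R : realType) (U A : hilbertType R)
  (G : U * A -> U) (S : A -> U)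
  (G_C1 : lipschitz_C1 G) (S_C1 : lipschitz_C1 S)
  (GS : forall alpha : A,
     grad S alpha \ob grad1 G (S alpha, alpha) + grad2 G (S alpha, alpha) = 0)
  (Q : blin U U) (Q_sa : selfadjoint Q) (Q_pos : posdef Q)
  (L_b L_A zeta gamma_N L_gradS : R)
  (b_lip : forall v w : U * A,
     normQinv Q (adjb G v - adjb G w) <= L_b * normQprod Q (v - w))
  (A_lip : forall v w : U * A,
     opnormP Q (adjA G v \- adjA G w) <= L_A * normQprod Q (v - w))
  (gradS_lip : forall alpha beta : A,
     normQinv Q (grad S alpha - grad S beta) <= L_gradS * `|alpha - beta|)
  (zeta_gt0 : 0 < zeta) (zeta_lt1 : zeta < 1) (gamma_gt0 : 0 < gamma_N)
  (N M Ninv : U * A -> blin U A -> blin U A)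
  (N_bounded : forall v, bounded_op (normQinv Q) (N v))
  (M_bounded : forall v, bounded_op (normQinv Q) (M v))
  (Ninv_bounded : forall v, bounded_op (normQinv Q) (Ninv v))
  (NK : forall v, cancel (N v) (Ninv v))
  (NinvK : forall v, cancel (Ninv v) (N v))
  (A_split : forall v p, adjA G v p = N v p + M v p)
  (NinvM_le : forall v, opnormP Q (Ninv v \o M v) <= zeta)
  (Ninv_le : forall v, gamma_N * opnormP Q (Ninv v) <= 1)
  (V_alpha : set A) (u : U) (alpha : A) (alpha_V : V_alpha alpha)
  (p p' : blin U A)
  (p'_def : N (u, alpha) p' + M (u, alpha) p = adjb G (u, alpha)) :
  let kappa_p := zeta^-1 in
  let C_S : \bar R := ereal_sup
    [set (zeta^-1 * gamma_N^-1 * (L_A * normQinv Q (grad S a) + L_b))%:E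
       | a in V_alpha] in
  let pi_p := L_gradS in
  forall beta : A, V_alpha beta ->
    ((kappa_p * normQinv Q (p' - grad S alpha))%:E <=
      (normQinv Q (p - grad S beta))%:E
      + C_S * (normQ Q (u - S alpha))%:E
      + (pi_p * `|alpha - beta|)%:E)%E.
Proof.
move=> kappa_p C_S pi_p beta beta_V; rewrite {}/kappa_p {}/pi_p.
set v := (u, alpha) in p'_def; set g := grad S alpha.
pose v0 := (S alpha, alpha); pose nP := @normQinv R U A Q.
have nP_ge0 (q : blin U A) : 0 <= nP q by exact: normQinv_ge0.
have nPD (q r : blin U A) : nP (q + r) <= nP q + nP r by exact: ler_normQinvD.
have nPZ a (q : blin U A) : nP (a *: q) <= `|a| * nP q by exact: ler_normQinvZ.
have dist_v0 : normQprod Q (v - v0) = normQ Q (u - S alpha).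
  rewrite -(normQprod_fst (V := A)); congr normQprod.
  by rewrite /v /v0 -[LHS]/(u - S alpha, alpha - alpha) subrr.
(* The splitting supplies the boundedness of [A_v] that makes its operator norm
   meaningful. *)
have adjA_bounded w : bounded_op nP (adjA G w).
  have -> : adjA G w = fun q => 1 *: N w q + M w q.
    by apply/funext => q; rewrite scale1r A_split.
  exact: bounded_op_lincomb.
have adjAB_le : nP (adjA G v g - adjA G v0 g) <=
    L_A * normQ Q (u - S alpha) * nP g.
  have -> : adjA G v g - adjA G v0 g = (adjA G v \- adjA G v0) g by [].
  apply: le_opnorm_op => //; last by rewrite -dist_v0; exact: A_lip.
  have -> : (adjA G v \- adjA G v0) = fun q => (-1) *: adjA G v0 q + adjA G v q.
    by apply/funext => q; rewrite scaleN1r addrC.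
  exact: bounded_op_lincomb.
have v0_solved : adjA G v0 g = adjb G v0.
  by apply/eqP; rewrite /adjb -addr_eq0; apply/eqP; exact: GS.
have residual_le : nP (adjb G v - (N v g + M v g)) <=
    (L_A * nP g + L_b) * normQ Q (u - S alpha).
  have -> : adjb G v - (N v g + M v g) =
      (adjb G v - adjb G v0) + (-1) *: (adjA G v g - adjA G v0 g).
    by rewrite -A_split scaleN1r opprB v0_solved addrA subrK.
  apply: le_trans (nPD _ _) _; rewrite mulrDl addrC mulrAC; apply: lerD.
    by apply: le_trans (nPZ _ _) _; rewrite normrN1 mul1r.
  by rewrite -dist_v0; exact: b_lip.
have p_le : nP (p - g) <= nP (p - grad S beta) + L_gradS * `|alpha - beta|.
  have -> : p - g = (p - grad S beta) + (-1) *: (g - grad S beta).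
    by rewrite scaleN1r opprB addrA subrK.
  apply: le_trans (nPD _ _) _; apply: lerD => //.
  by apply: le_trans (nPZ _ _) _; rewrite normrN1 mul1r; exact: gradS_lip.
have real_bound : zeta^-1 * nP (p' - g) <= nP (p - grad S beta)
    + zeta^-1 * gamma_N^-1 * (L_A * nP g + L_b) * normQ Q (u - S alpha)
    + L_gradS * `|alpha - beta|.
  rewrite addrAC ler_pdivrMl//.
  apply: le_trans (splitting_step_error_le (gamma := gamma_N) nP_ge0 nPD nPZ g
    (N_bounded v) (M_bounded v) (Ninv_bounded v) (NK v) (NinvM_le v)
    gamma_gt0 (Ninv_le v) p'_def) _.
  rewrite addrC mulrDr; apply: lerD; last by rewrite ler_wpM2l// ltW.
  by rewrite !mulrA divff ?gt_eqF// mul1r -mulrA ler_wpM2l// invr_ge0 ltW.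
have C_S_ge : ((zeta^-1 * gamma_N^-1 * (L_A * nP g + L_b))%:E <= C_S)%E.
  by apply: ereal_sup_ubound; exists alpha.
apply: (@le_trans _ _ (nP (p - grad S beta)
    + zeta^-1 * gamma_N^-1 * (L_A * nP g + L_b) * normQ Q (u - S alpha)
    + L_gradS * `|alpha - beta|)%:E); first by rewrite lee_fin.
rewrite !EFinD EFinM leeD2r// leeD2l//.
by apply: lee_wpmul2r => //; rewrite lee_fin normQ_ge0.
Qed.
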